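(* For a positive integer $n$, call an $n^2\times n^2$ array, with rows and columns indexed by $[n]^2$ and entries from a fixed set of $n^2$ symbols, a Sudoku square of order $n$ if every symbol appears exactly once in each row, exactly once in each column, and exactly once in each of the $n^2$ boxes, where the box indexed by $(a,b)\in[n]^2$ consists of all cells in rows $(a,a')$ and columns $(b,b')$ with $a',b'\in[n]$ (so the boxes are $n\times n$ subsquares partitioning the array). Then, as $n\to\infty$, the number of Sudoku squares of order $n$ is $\left(n^2/e^3+o(n^2)\right)^{n^4}$. *)

(* Defs.v *)
From mathcomp Require Import all_boot.

Set Implicit Arguments.
Unset Strict Implicit.
Unset Printing Implicit Defensive.

(* The index set [n]^2 of both the rows and the columns. *)
Definition line (n : nat) : finType := ('I_n * 'I_n)%type.

(* Arrays; the n^2 symbols are taken to be the elements of 'I_(n ^ 2). *)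
Definition array (n : nat) : finType := {ffun line n * line n -> 'I_(n ^ 2)}.

Definition row_cells (n : nat) (r : line n) : {set line n * line n} :=
  [set x | x.1 == r].

Definition col_cells (n : nat) (c : line n) : {set line n * line n} :=
  [set x | x.2 == c].

Definition box_cells (n : nat) (a b : 'I_n) : {set line n * line n} :=
  [set x | (x.1.1 == a) && (x.2.1 == b)].

Definition each_once (n : nat) (A : array n) (B : {set line n * line n}) : bool :=
  [forall s : 'I_(n ^ 2), #|[set x in B | A x == s]| == 1].

Definition is_sudoku (n : nat) (A : array n) : bool :=
  [&& [forall r : line n, each_once A (row_cells r)],
      [forall c : line n, each_once A (col_cells c)]
    & [forall a : 'I_n, forall b : 'I_n, each_once A (box_cells a b)]].

Definition num_sudoku (n : nat) : nat := #|[set A : array n | is_sudoku A]|.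

(* Main.v *)
(** A Sudoku square can be built in two independent stages.  In each band of [n]
    rows, choose in which stack (column block) every symbol of every row lies:
    this is a sequence of [n] disjoint maps from symbols to stacks, all of whose
    fibres have size [n].  Then, in each stack separately, the edges (row,
    symbol) form an [n]-regular bipartite graph on [n^2 + n^2] vertices, and its
    [n] columns are disjoint perfect matchings.  The row, column and box
    constraints say exactly this, so everything reduces to estimating the number
    of perfect matchings of a [d]-regular bipartite graph on [N + N] vertices.

    Upper bound: Bregman's theorem gives [(d!)^(N/d)].

    Lower bound [(d/e)^N]: replace every vertex by [k = 2^m] copies.  Doubling
    all vertices of a graph with [M] perfect matchings on [N + N] vertices
    yields at most [4^N * M^2] of them, because the union of two perfect
    matchings is 2-colourable; hence the blow-up has at most [k^(Nk) * M^k].  It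
    also has at least [(d^k / (k+1)^d)^N * (k!)^N]: by Hall's theorem the graph
    is a union of [d] perfect matchings, so every map from the copies of a
    vertex to the [d] colours with a fixed (popular) colour profile may be used
    at each vertex.  Now let [m] tend to infinity. *)

Require Import Defs.
From mathcomp Require Import all_boot all_fingroup.
From mathcomp Require Import ring.

Set Implicit Arguments.
Unset Strict Implicit.
Unset Printing Implicit Defensive.

(** * Matchings with prescribed fibre size *)

(** Stage one uses [w = n], since each row puts [n] symbols into each stack; stage two uses [w = 1],
    where these maps are perfect matchings. *)
Definition wmatch (X Y : finType) (w : nat) (e : X -> Y -> bool) :
    {set {ffun X -> Y}} :=
  [set f : {ffun X -> Y} | [forall x, e x (f x)]
     && [forall y, #|[set x | f x == y]| == w]].

Lemma wmatchP (X Y : finType) (w : nat) (e : X -> Y -> bool)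
    (f : {ffun X -> Y}) :
  reflect ((forall x, e x (f x)) /\ (forall y, #|[set x | f x == y]| = w))
          (f \in wmatch w e).
Proof.
rewrite inE; apply: (iffP andP) => -[H1 H2]; split.
- exact/forallP.
- by move=> y; apply/eqP/(forallP H2).
- exact/forallP.
- by apply/forallP=> y; rewrite H2.
Qed.

Lemma wmatch1_inj (X Y : finType) (e : X -> Y -> bool) (f : {ffun X -> Y}) :
  f \in wmatch 1 e -> injective f.
Proof.
case/wmatchP => _ H x x' Exx'; have /eqP/cards1P[a Ha] := H (f x').
have: x \in [set x | f x == f x'] by rewrite inE Exx'.
have: x' \in [set x | f x == f x'] by rewrite inE.
by rewrite Ha !inE => /eqP-> /eqP->.
Qed.

Lemma card_fibers (X Y : finType) (f : X -> Y) :
  \sum_y #|[set x | f x == y]| = #|X|.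
Proof.
rewrite -sum1_card (partition_big f predT) //=; apply: eq_bigr => y _.
by rewrite -sum1_card; apply: eq_bigl => x; rewrite inE.
Qed.

Lemma wmatch_card (X Y : finType) w (e : X -> Y -> bool) f :
  f \in wmatch w e -> #|X| = w * #|Y|.
Proof.
case/wmatchP => _ H; rewrite -(card_fibers f).
by rewrite (eq_bigr _ (fun y _ => H y)) sum_nat_const mulnC.
Qed.

Lemma wmatch1_intro (X Y : finType) (e : X -> Y -> bool) (f : {ffun X -> Y}) :
  #|X| = #|Y| -> injective f -> (forall x, e x (f x)) -> f \in wmatch 1 e.
Proof.
move=> cXY injf H; apply/wmatchP; split=> // y.
have /(_ y) : forall y, y \in codom f by apply: inj_card_onto; rewrite ?cXY.
case/codomP => x ->; apply/eqP/cards1P; exists x.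
by apply/setP=> z; rewrite !inE (inj_eq injf).
Qed.

Lemma wmatch1_inv (X Y : finType) (e : X -> Y -> bool) (f : {ffun X -> Y}) :
  f \in wmatch 1 e -> exists2 g, cancel f g & cancel g f.
Proof.
move=> Hf; have injf := wmatch1_inj Hf.
have cXY := wmatch_card Hf; rewrite mul1n in cXY.
have [g gK g'K] : bijective f by apply: inj_card_bij; rewrite ?cXY.
by exists g.
Qed.

(** Number the elements of each fibre by their position in its enumeration. *)
Lemma card_fiber_fun (X Y : finType) (f : X -> Y) (x : X) (K : finType) :
  (forall y, #|[set x | f x == y]| = #|K|) ->
  exists phi : X -> K, injective (fun x => (f x, phi x)).
Proof.
move=> H.
have K0 : 0 < #|K| by rewrite -(H (f x)); apply/card_gt0P; exists x; rewrite inE.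
have k0 : K := enum_val (Ordinal K0).
pose A y := [set x | f x == y].
exists (fun x => nth k0 (enum K) (index x (enum (A (f x))))) => x1 x2 [E].
have lt z : index z (enum (A (f z))) < size (enum K).
  by rewrite -cardE -(H (f z)) cardE index_mem mem_enum inE.
move/eqP; rewrite nth_uniq ?enum_uniq // E => /eqP E2.
have := congr1 (nth x1 (enum (A (f x2)))) E2.
by rewrite !nth_index // mem_enum inE ?E.
Qed.

(** Projecting to [Y] turns a perfect matching into a [#|K|]-to-one map; such a map lifts by
    choosing, over every [y], a bijection of its fibre with [K]. *)
Lemma card_wmatch_blowup (X Y K : finType) (e : X -> Y -> bool) :
  #|wmatch 1 (fun x (p : Y * K) => e x p.1)| =
  #|wmatch #|K| e| * (#|K|`!) ^ #|Y|.
Proof.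
pose pr (g : {ffun X -> Y * K}) := [ffun x => (g x).1].
have prP g : g \in wmatch 1 (fun x (p : Y * K) => e x p.1) -> pr g \in wmatch #|K| e.
  move=> Hg; have [g' gK g'K] := wmatch1_inv Hg; case/wmatchP: (Hg) => H1 H2.
  apply/wmatchP; split => [x|y]; first by rewrite ffunE.
  have -> : [set x | pr g x == y] = [set g' (y, k) | k in K].
    apply/setP=> x; rewrite inE ffunE; apply/eqP/imsetP => [<-|[k _ ->]].
      by exists (g x).2; rewrite // -surjective_pairing gK.
    by rewrite g'K.
  by rewrite card_imset // => k k' /(can_inj g'K) [].
rewrite -sum1_card (partition_big pr (mem (wmatch #|K| e))) //=.
rewrite -sum_nat_const; apply: eq_bigr => f Hf.
have cXY := wmatch_card Hf; case/wmatchP: (Hf) => Hf1 Hf2.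
(* The reference labelling below needs a point of [X]. If [X] is empty, so is [K] or [Y], and the
   only lift is the empty function. *)
case: (pickP X) => [x0 _|X0]; last first.
  have k1 : forall y : Y, #|K| = 0.
    by move=> y; rewrite -(Hf2 y); apply: eq_card0 => x; have := X0 x.
  have -> : #|K|`! ^ #|Y| = 1.
    case: (pickP Y) => [y _|Y0]; first by rewrite (k1 y) exp1n.
    by rewrite (eq_card0 Y0).
  have E (g h : {ffun X -> Y * K}) : g = h by apply/ffunP => x; have := X0 x.
  pose g : {ffun X -> Y * K} := ffun0 (eq_card0 X0).
  rewrite (big_pred1 g) // => h; rewrite (E h g) /= eqxx.
  apply/andP; split; last by apply/eqP/ffunP => x; have := X0 x.
  apply: wmatch1_intro; try by move=> x; have := X0 x.
  by rewrite card_prod cXY mulnC.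
have [phi injphi] := card_fiber_fun x0 Hf2.
(* Relative to the labelling [phi], a lift of [f] is one permutation of [K] for each [y]. *)
pose ph (p : {ffun Y -> {perm K}}) := [ffun x => (f x, p (f x) (phi x))].
have injph : injective ph.
  move=> p q /ffunP E; apply/ffunP=> y; apply/permP => k.
  have [g gK g'K] : bijective (fun x => (f x, phi x)).
    by apply: inj_card_bij => //; rewrite card_prod cXY mulnC.
  have := E (g (y, k)); rewrite !ffunE; have := g'K (y, k) => -[-> ->].
  by case.
rewrite -[RHS](_ : #|{ffun Y -> {perm K}}| = _); last first.
  rewrite card_ffun; congr (_ ^ _); rewrite -[in RHS](cardsT K) -card_perm.
  by apply: eq_card => p; rewrite inE; apply/esym/subsetP => x; rewrite inE.
rewrite -(card_imset _ injph) sum1dep_card; apply: eq_card => g.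
rewrite !inE; apply/idP/imsetP => [/andP[Hg /eqP Eg]|[p _ ->]].
  have {}Hg : g \in wmatch 1 (fun x (p : Y * K) => e x p.1) by rewrite inE.
  have injg := wmatch1_inj Hg.
  have [h gK g'K] : bijective (fun x => (f x, phi x)).
    by apply: inj_card_bij => //; rewrite card_prod cXY mulnC.
  have fh y k : f (h (y, k)) = y by have [] := g'K (y, k).
  have gh x : (g x).1 = f x by rewrite -Eg ffunE.
  have ip y : injective (fun k => (g (h (y, k))).2).
    move=> k k' E.
    have /injg/(can_inj g'K)[] // : g (h (y, k)) = g (h (y, k')).
    by rewrite [LHS]surjective_pairing [RHS]surjective_pairing !gh !fh E.
  exists [ffun y => perm (ip y)] => //; apply/ffunP => x.
  by rewrite !ffunE permE gK -gh -surjective_pairing.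
have Hph : ph p \in wmatch 1 (fun x (p : Y * K) => e x p.1).
  apply: wmatch1_intro; first by rewrite card_prod cXY mulnC.
    by move=> x x'; rewrite !ffunE => -[E]; rewrite E => /perm_inj E2;
      apply: injphi; rewrite E E2.
  by move=> x; rewrite ffunE.
move: Hph; rewrite inE => -> /=.
by apply/eqP/ffunP=> x; rewrite !ffunE.
Qed.

(** * Hall's theorem *)

(* Halmos and Vaughan: split along a tight set if there is one, and otherwise
   match an arbitrary point arbitrarily. *)
Lemma hall (X Y : finType) (y0 : Y) (e : X -> {set Y}) (A : {set X}) :
  (forall S : {set X}, S \subset A -> #|S| <= #|\bigcup_(x in S) e x|) ->
  exists2 f : X -> Y, {in A &, injective f} & forall x, x \in A -> f x \in e x.
Proof.
elim: {A}#|A|.+1 {-2}A (ltnSn #|A|) e => // m IH A; rewrite ltnS => Am e H.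
have [->|/set0Pn[x0 x0A]] := eqVneq A set0.
  by exists (fun=> y0) => x; rewrite inE.
case: (pickP [pred S : {set X} | [&& S != set0, S \proper A
         & #|\bigcup_(x in S) e x| <= #|S|]]) => [S /= /and3P[S0 SA tS]|Hex].
- have sSA := proper_sub SA.
  have [f injf Hf] : exists2 f : X -> Y, {in S &, injective f}
      & forall x, x \in S -> f x \in e x.
    apply: IH => [|T TS]; first by apply: leq_trans (proper_card SA) Am.
    by apply: H; apply: subset_trans TS sSA.
  pose N := \bigcup_(x in S) e x.
  have [g injg Hg] : exists2 g : X -> Y, {in A :\: S &, injective g}
      & forall x, x \in A :\: S -> g x \in e x :\: N.
    apply: IH => [|T TS].
      have [x xS] := set0Pn _ S0; apply: leq_trans Am; apply: proper_card.
      apply/properP; split; first exact: subsetDl.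
      by exists x; rewrite ?inE ?xS // (subsetP sSA).
    (* Hall's condition for [T :|: S], less the at most [#|S|] elements of [N], leaves [#|T|]
       neighbours of [T] outside [N]. *)
    have TS0 : T :&: S = set0.
      apply/setP=> x; rewrite !inE; apply/negP=> /andP[xT xS].
      by have := subsetP TS _ xT; rewrite inE xS.
    have cTS : #|T :|: S| = #|T| + #|S| by rewrite cardsU TS0 cards0 subn0.
    have := H (T :|: S); rewrite cTS bigcup_setU.
    have -> : \bigcup_(x in T) e x :|: \bigcup_(x in S) e x
            = \bigcup_(x in T) (e x :\: N) :|: N.
      rewrite -/N; apply/setP=> y; rewrite !in_setU.
      case yN: (y \in N); rewrite ?orbT // !orbF;
        apply/bigcupP/bigcupP => -[x xT xy]; exists x => //.
        by rewrite inE yN.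
      by move: xy; rewrite inE => /andP[].
    have -> : T :|: S \subset A.
      by rewrite subUset sSA andbT; apply: subset_trans TS _; apply: subsetDl.
    move/(_ isT)/leq_trans/(_ (leq_card_setU _ _)) => H2.
    by rewrite -(leq_add2r #|S|); apply: leq_trans H2 _; rewrite leq_add2l.
  exists (fun x => if x \in S then f x else g x) => [x x' xA x'A|x xA]; last first.
    case: ifP => xS; first exact: Hf.
    by have := Hg x; rewrite !inE xS xA => /(_ isT) /andP[].
  have fN z : z \in S -> f z \in N by move=> zS; apply/bigcupP; exists z => //; apply: Hf.
  have gN z : z \in A -> z \notin S -> g z \notin N.
    by move=> zA zS; have := Hg z; rewrite !inE zS zA => /(_ isT) /andP[].
  case: ifPn => xS; case: ifPn => x'S; first exact: injf.
  - by move=> E; have := gN _ x'A x'S; rewrite -E fN.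
  - by move=> E; have := gN _ xA xS; rewrite E fN.
  - by apply: injg; rewrite inE ?xS ?x'S.
have := H [set x0]; rewrite sub1set x0A big_set1 cards1 => /(_ isT) /card_gt0P[y1 y1e].
have [f injf Hf] : exists2 f : X -> Y, {in A :\ x0 &, injective f}
    & forall x, x \in A :\ x0 -> f x \in e x :\ y1.
  apply: IH => [|S SA]; first by rewrite (cardsD1 x0) x0A in Am.
  have [->|S0] := eqVneq S set0; first by rewrite cards0.
  have pS : S \proper A by apply: sub_proper_trans SA (properD1 x0A).
  have := Hex S; rewrite /= S0 pS /= leqNgt => /negbFE lt.
  have sub : \bigcup_(x in S) e x :\ y1 \subset \bigcup_(x in S) (e x :\ y1).
    apply/subsetP=> y; rewrite inE => /andP[yy1 /bigcupP[x xS xy]].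
    by apply/bigcupP; exists x => //; rewrite inE yy1.
  apply: leq_trans (subset_leq_card sub); rewrite -ltnS; apply: leq_trans lt _.
  by rewrite (cardsD1 y1 (\bigcup_(x in S) e x)) -add1n leq_add2r leq_b1.
exists (fun x => if x == x0 then y1 else f x) => [x x' xA x'A|x xA]; last first.
  case: eqP => [->//|/eqP xx0].
  by have := Hf x; rewrite !inE xx0 xA => /(_ isT) /andP[].
case: (eqVneq x x0) => [->|xx0]; case: (eqVneq x' x0) => [->//|x'x0].
- move=> E; have := Hf x'; rewrite !inE x'x0 x'A => /(_ isT) /andP[].
  by rewrite -E eqxx.
- move=> E; have := Hf x; rewrite !inE xx0 xA => /(_ isT) /andP[].
  by rewrite E eqxx.
- by apply: injf; rewrite !inE ?xx0 ?x'x0.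
Qed.

Lemma double_count (X Y : finType) (A : {pred X}) (B : {pred Y}) (e : X -> Y -> bool) :
  \sum_(x in A) #|[set y in B | e x y]| = \sum_(y in B) #|[set x in A | e x y]|.
Proof.
under eq_bigr do rewrite -sum1dep_card.
under [in RHS]eq_bigr do rewrite -sum1dep_card.
rewrite (exchange_big_dep (mem B)) /=; last by move=> x y _ /andP[].
by apply: eq_bigr => y yB; apply: eq_bigl => x; rewrite yB.
Qed.

(** Two degrees, because the graph of symbols against stacks is unbalanced. *)
Definition regular (X Y : finType) d d' (e : X -> Y -> bool) :=
  (forall x, #|[set y | e x y]| = d) /\ (forall y, #|[set x | e x y]| = d').

Lemma regular_card (X Y : finType) d d' (e : X -> Y -> bool) :
  regular d d' e -> #|X| * d = #|Y| * d'.
Proof.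
case=> [H1 H2]; have := double_count (mem X) (mem Y) e.
rewrite (eq_bigr (fun=> d)) => [|x _]; last
   by rewrite -(H1 x); apply: eq_card => y; rewrite !inE.
rewrite [in RHS](eq_bigr (fun=> d')) => [|y _]; last
   by rewrite -(H2 y); apply: eq_card => x; rewrite !inE.
by rewrite !sum_nat_const.
Qed.

(** Hall's condition by counting edges: [S] emits [d.+1] edges per point, and each neighbour absorbs
    at most [d.+1] of them. *)
Lemma regular_matching (X Y : finType) d (e : X -> Y -> bool) :
  regular d.+1 d.+1 e -> exists f, f \in wmatch 1 e.
Proof.
move=> H; have /eqP := regular_card H; rewrite eqn_pmul2r // => /eqP cXY.
case: H => H1 H2; case: (pickP X) => [x0 _|X0]; last first.
  exists (ffun0 (eq_card0 X0)); apply: wmatch1_intro => //; by move=> x; have := X0 x.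
have /card_gt0P[y0 _] : 0 < #|[set y | e x0 y]| by rewrite H1.
have [|f injf Hf] := @hall X Y y0 (fun x => [set y | e x y]) setT.
  move=> S _; rewrite -(leq_pmul2r (ltn0Sn d)) -sum_nat_const.
  rewrite (eq_bigr (fun x => #|[set y in \bigcup_(x in S) [set y | e x y] | e x y]|)).
    rewrite double_count -sum_nat_const leq_sum // => y _; rewrite -(H2 y).
    by apply: subset_leq_card; apply/subsetP=> x; rewrite !inE => /andP[].
  move=> x xS; rewrite -(H1 x); congr #|pred_of_set _|; apply/setP=> y; rewrite !inE.
  case exy: (e x y); rewrite ?andbF // andbT; apply/esym/bigcupP; exists x => //.
  by rewrite inE.
exists (finfun f); apply: wmatch1_intro => //.
  by move=> x x'; rewrite !ffunE; apply: injf; rewrite inE.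
by move=> x; rewrite ffunE; have := Hf x; rewrite !inE; apply.
Qed.

(** * Perfect matchings of a doubled graph *)

(* The union of two perfect matchings is bipartite: [a] exchanges the orbits of
   [b \o a] without fixing any of them. *)
Lemma two_involutions_coloring (X : finType) (a b : X -> X) :
  involutive a -> involutive b -> (forall x, a x != x) -> (forall x, b x != x) ->
  exists chi : X -> bool,
    (forall x, chi (a x) = ~~ chi x) /\ (forall x, chi (b x) = ~~ chi x).
Proof.
move=> aK bK an bn; pose g := b \o a.
have injg : injective g by apply: inj_comp; apply: inv_inj.
(* Since [g (a (g x)) = a x], an equation for [m.+2] at [x] descends to one for [m] at [g x]; the
   base cases would be fixed points of [a] or of [b]. *)
have iter_ne m x : iter m g x <> a x /\ iter m.+1 g x <> a x.
  elim: m x => [|m IH] x.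
    by split=> /= E; [move/eqP: (an x); apply | move/eqP: (bn (a x)); apply].
  split; first by case: (IH x).
  rewrite iterSr /= => E; have [H _] := IH (g x); apply: H.
  by apply: injg; rewrite E /g /= aK bK.
have root_ne x : froot g x != froot g (a x).
  apply/eqP=> /eqP; rewrite (root_connect (fconnect_sym injg)) => /iter_findex E.
  by have [] := iter_ne (findex g x (a x)) x.
have root_g x : froot g (g x) = froot g x.
  by apply/esym/(rootP (fconnect_sym injg)); apply: fconnect1.
(* Ranking the orbits lets [chi] single out one of the two orbits that [a] exchanges; [b x] lies in
   the orbit of [a x]. *)
pose r x : nat := enum_rank (froot g x).
have r_ne x : r x != r (a x) by rewrite (inj_eq val_inj) (inj_eq enum_rank_inj).
exists (fun x => r x < r (a x)); split=> x.
  by rewrite aK -leqNgt ltn_neqAle eq_sym r_ne.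
have -> : r (b x) = r (a x) by rewrite /r -(root_g (a x)) /g /= aK.
have -> : r (a (b x)) = r x by rewrite /r -(root_g (a (b x))) /g /= aK bK.
by rewrite -leqNgt ltn_neqAle eq_sym r_ne.
Qed.

Definition blowup (X Y K : finType) (e : X -> Y -> bool) (p : X * K) (q : Y * K) :=
  e p.1 q.1.
Arguments blowup {X Y} K e p q.

(** Identifying the two copies of each vertex turns a matching into a 2-regular multigraph on
    [X * K] and [Y * K]. A proper 2-colouring of its edges splits it into two perfect matchings, and
    one bit per vertex recovers the original. *)
Lemma card_wmatch_double (X Y K : finType) (e : X -> Y -> bool) :
  #|X| = #|Y| ->
  #|wmatch 1 (blowup (K * bool)%type e)| <=
  4 ^ (#|X| * #|K|) * #|wmatch 1 (blowup K e)| ^ 2.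
Proof.
move=> cXY; set W := wmatch 1 (blowup K e).
(* The bits [u.2.1] and [u.2.2] say which copy of a vertex of either side belongs to the first
   matching. *)
pose F (u : ({ffun X * K -> Y * K} * {ffun X * K -> Y * K})
          * ({ffun X * K -> bool} * {ffun Y * K -> bool})) :=
  [ffun z : X * (K * bool) => let p := (z.1, z.2.1) in
    if z.2.2 == u.2.1 p then let q := u.1.1 p in (q.1, (q.2, u.2.2 q))
    else let q := u.1.2 p in (q.1, (q.2, ~~ u.2.2 q))].
suff sub : wmatch 1 (blowup (K * bool)%type e) \subset F @: setX (setX W W) setT.
  apply: leq_trans (subset_leq_card sub) _; apply: leq_trans (leq_imset_card _ _) _.
  rewrite !cardsX cardsT card_prod !card_ffun card_bool !card_prod -cXY.
  by rewrite -expnD addnn -mul2n expnM mulnC mulnn.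
apply/subsetP=> f Hf; have [h fK hK] := wmatch1_inv Hf.
case/wmatchP: (Hf) => Hf1 _.
pose flip (Z : finType) (z : Z * (K * bool)) := (z.1, (z.2.1, ~~ z.2.2)).
have flipK Z : involutive (@flip Z) by move=> [z [k b]]; rewrite /flip /= negbK.
have flipN Z z : @flip Z z != z.
  by case: z => z [k b]; rewrite /flip /= !xpair_eqE; case: b; rewrite !andbF.
(* An edge is named by its end in [X * (K * bool)]; the two involutions pass to the other edge at
   the same vertex of [X * K], respectively of [Y * K]. *)
have [chi [chia chib]] : exists chi : X * (K * bool) -> bool,
    (forall x, chi (flip _ x) = ~~ chi x) /\
    (forall x, chi (h (flip _ (f x))) = ~~ chi x).
  apply: (@two_involutions_coloring _ (flip X) (fun x => h (flip Y (f x)))) => //.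
  - exact: flipK.
  - by move=> x /=; rewrite hK flipK fK.
  - exact: flipN.
  by move=> x /=; rewrite -(inj_eq (can_inj fK)) hK flipN.
pose c := [ffun p : X * K => chi (p.1, (p.2, true))].
pose c' := [ffun q : Y * K => chi (h (q.1, (q.2, true)))].
have chiE x k b : chi (x, (k, b)) = (b == c (x, k)).
  rewrite ffunE /=; case: b => //.
  by rewrite (chia (x, (k, true))).
have chihE y k b : chi (h (y, (k, b))) = (b == c' (y, k)).
  rewrite ffunE /=; case: b => //.
  by have := chib (h (y, (k, true))); rewrite hK => ->.
pose s := [ffun p : X * K => let q := f (p.1, (p.2, c p)) in (q.1, q.2.1)].
pose t := [ffun p : X * K => let q := f (p.1, (p.2, ~~ c p)) in (q.1, q.2.1)].
(* [f] sends the copies selected by [c] exactly to those selected by [c'], so [s] and [t] are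
   injective. *)
have bitE z : (z.2.2 == c (z.1, z.2.1)) = ((f z).2.2 == c' ((f z).1, (f z).2.1)).
  case: z => x [k b] /=; rewrite -chiE -chihE; congr chi.
  by rewrite -[(_, ((f _).2.1, _))]/(_, (_, _)) -!surjective_pairing fK.
have trip (u v : Y * (K * bool)) : u.1 = v.1 -> u.2.1 = v.2.1 -> u.2.2 = v.2.2 -> u = v.
  by case: u v => [? [? ?]] [? [? ?]] /= -> -> ->.
have cWW : #|{: X * K}| = #|{: Y * K}| by rewrite !card_prod cXY.
have sW : s \in W.
  apply: wmatch1_intro => // [[x k] [x' k']|[x k]]; last first.
    by rewrite ffunE /blowup /=; apply: (Hf1 (x, (k, _))).
  rewrite [s (x, k)]ffunE [s (x', k')]ffunE /=.
  have := bitE (x, (k, c (x, k))); have := bitE (x', (k', c (x', k'))).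
  rewrite /= !eqxx.
  set u := f _; set v := f _ => /esym/eqP Ev /esym/eqP Eu [E1 E2].
  have E3 : u.2.2 = v.2.2 by rewrite Eu Ev E1 E2.
  have : u = v by apply: trip.
  by move/(can_inj fK) => [-> ->].
have tW : t \in W.
  apply: wmatch1_intro => // [[x k] [x' k']|[x k]]; last first.
    by rewrite ffunE /blowup /=; apply: (Hf1 (x, (k, _))).
  rewrite [t (x, k)]ffunE [t (x', k')]ffunE /=.
  have := bitE (x, (k, ~~ c (x, k))); have := bitE (x', (k', ~~ c (x', k'))).
  have nb (b : bool) : (~~ b == b) = false by case: b.
  rewrite /= !nb.
  set u := f _; set v := f _ => Ev Eu [E1 E2].
  have : u.2.2 = v.2.2.
    by move: Eu Ev; rewrite E1 E2; case: u.2.2; case: v.2.2; case: (c' _).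
  move=> E3; have : u = v by apply: trip.
  by move/(can_inj fK) => [-> ->].
apply/imsetP; exists ((s, t), (c, c')); first by rewrite in_setX in_setT andbT in_setX sW tW.
apply/ffunP => -[x [k b]]; rewrite [RHS]ffunE.
have /= B := bitE (x, (k, b)); rewrite [RHS]/=.
case: eqP B => [Eb|/eqP Eb] => /esym B.
  by rewrite [s _]ffunE /= -Eb; apply: trip => //=; apply/eqP.
have {}Eb : b = ~~ c (x, k) by move: Eb {B}; case: b; case: (c _).
rewrite [t _]ffunE /= -Eb; apply: trip => //=.
by move: B; case: (f _).2.2; case: (c' _).
Qed.

(** * Sequences of disjoint matchings *)

(** For [w = n] these are the rows of a band, as maps from symbols to stacks; for [w = 1], the
    columns of a stack, as maps from rows to symbols. *)
Definition wseq (X Y : finType) (w d : nat) (e : X -> Y -> bool) :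
    {set {ffun 'I_d -> {ffun X -> Y}}} :=
  [set F : {ffun 'I_d -> {ffun X -> Y}} | [forall c, F c \in wmatch w e]
     && [forall x, injectiveb (fun c => F c x)]].
Arguments wseq {X Y} w d e.

Lemma wseqP (X Y : finType) w d (e : X -> Y -> bool)
    (F : {ffun 'I_d -> {ffun X -> Y}}) :
  reflect ((forall c, F c \in wmatch w e) /\ (forall x, injective (fun c => F c x)))
          (F \in wseq w d e).
Proof.
rewrite inE; apply: (iffP andP) => -[H1 H2]; split.
- exact/forallP.
- by move=> x; apply/injectiveP/(forallP H2).
- exact/forallP.
- by apply/forallP=> x; apply/injectiveP.
Qed.

Definition rel_minus (X Y : finType) (e : X -> Y -> bool) (f : {ffun X -> Y}) x y :=
  e x y && (f x != y).

Lemma regular_minus (X Y : finType) w d (e : X -> Y -> bool) f :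
  regular d.+1 (w * d.+1) e -> f \in wmatch w e -> regular d (w * d) (rel_minus e f).
Proof.
case=> H1 H2 /wmatchP[Hf1 Hf2]; split=> [x|y].
  have := H1 x; rewrite (cardsD1 (f x)) inE Hf1 => -[<-].
  by apply: eq_card => y; rewrite !inE /rel_minus andbC eq_sym.
apply: (@addnI w); rewrite -mulnS -(H2 y) -{1}(Hf2 y).
rewrite -(cardsID [set x | f x == y] [set x | e x y]); congr (_ + _).
  by apply: eq_card => x; rewrite !inE; case: eqP => [<-|_]; rewrite ?Hf1 ?andbF.
by apply: eq_card => x; rewrite !inE andbC.
Qed.

(** Peel off the first matching; the others avoid it, hence live in [rel_minus e f]. *)
Lemma card_wseqS (X Y : finType) w d (e : X -> Y -> bool) :
  #|wseq w d.+1 e| = \sum_(f in wmatch w e) #|wseq w d (rel_minus e f)|.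
Proof.
pose hd (F : {ffun 'I_d.+1 -> {ffun X -> Y}}) := F ord0.
pose tl (F : {ffun 'I_d.+1 -> {ffun X -> Y}}) := [ffun c => F (lift ord0 c)].
pose cons f (G : {ffun 'I_d -> {ffun X -> Y}}) :=
  [ffun c => if unlift ord0 c is Some c' then G c' else f].
rewrite -sum1_card (partition_big hd (mem (wmatch w e))) /=; last first.
  by move=> F /wseqP[H _]; apply: H.
apply: eq_bigr => f Hf; rewrite sum1dep_card.
have injc : injective (cons f).
  move=> G G' /ffunP E; apply/ffunP => c; have := E (lift ord0 c).
  by rewrite !ffunE liftK.
rewrite -(card_imset _ injc); apply: eq_card => F; rewrite inE; apply/andP/imsetP.
  move=> [/wseqP[H1 H2] /eqP E]; exists (tl F).
    apply/wseqP; split=> [c|x c c' /=]; last by rewrite !ffunE => /H2/lift_inj.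
    have /wmatchP[H3 H4] := H1 (lift ord0 c).
    apply/wmatchP; split=> [x|y]; rewrite ffunE //.
    rewrite /rel_minus H3 /= -E; apply/eqP => /H2/eqP; apply/negP.
    exact: neq_lift.
  apply/ffunP=> c; rewrite ffunE; case: unliftP => [c' ->|->] //.
  by rewrite ffunE.
case=> G /wseqP[H1 H2] ->; split; last by rewrite /hd ffunE unlift_none.
apply/wseqP; split=> [c|x c c' /=].
  rewrite ffunE; case: unliftP => [c' _|_] //; have /wmatchP[H3 H4] := H1 c'.
  by apply/wmatchP; split=> // x; have /andP[] := H3 x.
have ne c0 : G c0 x <> f x.
  by move=> E; have /wmatchP[/(_ x) /andP[_]] := H1 c0; rewrite E eqxx.
rewrite !ffunE; case: unliftP => [c1 ->|->]; case: unliftP => [c1' ->|->] //.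
- by move/H2 => ->.
- by move/ne.
- by move/esym/ne.
Qed.

Lemma regular_wseq (X Y : finType) d (e : X -> Y -> bool) :
  regular d d e -> exists F, F \in wseq 1 d e.
Proof.
move=> H; suff : 0 < #|wseq 1 d e| by case/card_gt0P => F; exists F.
elim: d e H => [|d IH] e H.
  apply/card_gt0P; exists (ffun0 (card_ord 0)).
  by apply/wseqP; split=> [[]|? []].
have [f Hf] := regular_matching H; rewrite card_wseqS (bigD1 f) //=.
rewrite ltn_addr // IH // -[d in regular _ d]mul1n.
by apply: regular_minus; rewrite ?mul1n.
Qed.

(** Pigeonhole: there are at most [#|K|.+1 ^ d] vectors of fibre sizes, and [G] is a largest class
    of maps sharing one. *)
Lemma popular_profile (K : finType) d :
  exists G : {set {ffun K -> 'I_d}},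
    d ^ #|K| <= #|G| * #|K|.+1 ^ d /\
    (forall g g', g \in G -> g' \in G ->
      forall c, #|[set k | g k == c]| = #|[set k | g' k == c]|).
Proof.
pose p (g : {ffun K -> 'I_d}) : {ffun 'I_d -> 'I_#|K|.+1} :=
  [ffun c => inord #|[set k | g k == c]|].
pose N q := #|[set g | p g == q]|.
case: (@arg_maxnP _ [ffun=> ord0] predT N isT) => q _ Hq.
exists [set g | p g == q]; split.
  rewrite -{1}(card_ord d) -card_ffun -(card_fibers p) mulnC.
  apply: (@leq_trans (\sum_(y : {ffun 'I_d -> 'I_#|K|.+1}) N q)).
    by apply: leq_sum => r _; apply: Hq.
  by rewrite sum_nat_const card_ffun !card_ord.
move=> g g'; rewrite !inE => /eqP <- /eqP /ffunP E c; have := E c; rewrite !ffunE.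
by move/(congr1 val); rewrite /= !inordK // ltnS max_card.
Qed.

(** Split [e] into [d.+1] disjoint perfect matchings and send copy [k] of [x] along the one numbered
    [g x k], with [g x] in the popular class. Each colour brings one [x] to a given [y], with a
    number of copies independent of [x], so [y] is hit [#|K|] times in all. *)
Lemma card_wmatch_profile (X Y K : finType) d (e : X -> Y -> bool) :
  regular d.+1 d.+1 e -> exists2 L, d.+1 ^ #|K| <= L * #|K|.+1 ^ d.+1 &
    L ^ #|X| <= #|wmatch #|K| (fun (p : X * K) y => e p.1 y)|.
Proof.
move=> H; have [F /wseqP[HF injF]] := regular_wseq H.
have [G [HG1 HG2]] := popular_profile K d.+1; exists #|G| => //.
rewrite -card_ffun_on.
pose Phi (g : {ffun X -> {ffun K -> 'I_d.+1}}) : {ffun X * K -> Y} :=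
  [ffun p => F (g p.1 p.2) p.1].
have injPhi : injective Phi.
  move=> g g' /ffunP E; apply/ffunP=> x; apply/ffunP=> k.
  by have := E (x, k); rewrite !ffunE /= => /injF.
rewrite -(card_imset _ injPhi); apply/subset_leq_card/subsetP => _ /imsetP[g Hg ->].
have {}Hg x : g x \in G by apply/ffun_onP.
apply/wmatchP; split=> [[x k]|y].
  by rewrite ffunE /=; have /wmatchP[] := HF (g x k).
have [x0 _|X0] := pickP X; last first.
  by case: H => _ /(_ y); rewrite eq_card0 // => x; have := X0 x.
rewrite -(card_fibers (g x0)) -sum1dep_card.
transitivity (\sum_x \sum_(k | Phi g (x, k) == y) 1).
  by rewrite pair_big_dep; apply: eq_bigl => -[x k].
transitivity (\sum_x \sum_c (F c x == y) * #|[set k | g x0 k == c]|).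
  apply: eq_bigr => x _; rewrite (partition_big (g x) predT) //=.
  apply: eq_bigr => c _; rewrite (HG2 _ (g x)) // -sum1dep_card big_distrr /=.
  rewrite [in RHS](eq_bigl (fun k => g x k == c)) // [LHS]big_mkcondl /=.
  apply: eq_bigr => k /eqP E; rewrite ffunE /= E; by case: (_ == y).
rewrite exchange_big /=; apply: eq_bigr => c _; rewrite -big_distrl /=.
rewrite -big_mkcond /= sum1dep_card; have /wmatchP[_ ->] := HF c.
by rewrite mul1n.
Qed.

(** An iterated product with [bool], so that [card_wmatch_double] applies at each level as it
    stands. *)
Fixpoint bits (m : nat) : finType :=
  if m is m'.+1 then (bits m' * bool)%type else unit.

Lemma card_bits m : #|bits m| = 2 ^ m.
Proof.
by elim: m => [|m IH]; [rewrite card_unit | rewrite card_prod IH card_bool expnSr].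
Qed.

Lemma card_wmatch_bits (X Y : finType) (e : X -> Y -> bool) m :
  #|X| = #|Y| ->
  #|wmatch 1 (blowup (bits m) e)| <=
  (2 ^ m) ^ (#|X| * 2 ^ m) * #|wmatch 1 e| ^ (2 ^ m).
Proof.
move=> cXY; elim: m => [|m IH].
  rewrite !expn0 exp1n mul1n expn1.
  pose p (f : {ffun X * unit -> Y * unit}) := [ffun x => (f (x, tt)).1].
  have injp : injective p.
    move=> f g /ffunP E; apply/ffunP=> -[x []]; have := E x; rewrite !ffunE.
    by case: (f _) => [? []]; case: (g _) => [? []] /= ->.
  rewrite -(card_imset _ injp); apply/subset_leq_card/subsetP => _ /imsetP[f Hf ->].
  have inj := wmatch1_inj Hf; case/wmatchP: (Hf) => H1 _.
  apply: wmatch1_intro => // [x x'|x]; last by rewrite ffunE; apply: (H1 (x, tt)).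
  rewrite !ffunE; move: (inj (x, tt) (x', tt)).
  case: (f (x, _)) => [a []]; case: (f (x', _)) => [b []] H /= E.
  by have [] : (x, tt) = (x', tt) by apply: H; rewrite E.
apply: leq_trans (card_wmatch_double _ _ cXY) _; rewrite card_bits.
have {}IH := leq_mul IH IH; rewrite !mulnn in IH.
apply: leq_trans (leq_mul (leqnn _) IH) _.
rewrite expnMn -[4]/(2 ^ 2) -!expnM mulnA -expnD -expnSr leq_mul // leq_exp2l //.
by rewrite expnSr; apply/eq_leq; ring.
Qed.

(** Compares the lower and upper counts of perfect matchings of the blow-up by [2 ^ m] copies. *)
Lemma wmatch_lower_nat (X Y : finType) d (e : X -> Y -> bool) m :
  regular d.+1 d.+1 e ->
  (d.+1 ^ (2 ^ m) * (2 ^ m)`!) ^ #|X| <=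
  ((2 ^ m).+1 ^ d.+1) ^ #|X| *
    ((2 ^ m) ^ (#|X| * 2 ^ m) * #|wmatch 1 e| ^ (2 ^ m)).
Proof.
move=> H; have cXY : #|X| = #|Y|.
  by apply/eqP; rewrite -(eqn_pmul2r (ltn0Sn d)) (regular_card H).
have [L HL1 HL2] := card_wmatch_profile (bits m) H; rewrite card_bits in HL1 HL2.
have := card_wmatch_bits e m cXY.
rewrite -(leq_pmul2l (m := ((2 ^ m).+1 ^ d.+1) ^ #|X|)) ?expn_gt0 //.
apply: leq_trans.
have := card_wmatch_blowup (bits m) (fun (p : X * bits m) y => e p.1 y).
rewrite -[wmatch 1 _]/(wmatch 1 (blowup (bits m) e)) => ->.
rewrite -cXY card_bits.
apply: leq_trans (leq_mul (leqnn _) (leq_mul HL2 (leqnn _))).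
rewrite -!expnMn.
by case: #|X| => [|N]; rewrite ?expn0 // leq_exp2r // mulnA [_ * L]mulnC leq_mul.
Qed.

(** * The two-stage description of Sudoku squares *)

Lemma each_once_ex n (A : array n) B s :
  each_once A B -> exists2 x, x \in B & A x = s.
Proof.
move/forallP/(_ s)/cards1P => [x] E.
have : x \in [set x in B | A x == s] by rewrite E inE.
by rewrite inE => /andP[xB /eqP Ax]; exists x.
Qed.

(** A set with as many cells as there are symbols carries each symbol once as soon as none
    repeats. *)
Lemma each_onceP n (A : array n) (B : {set line n * line n}) :
  #|B| = n ^ 2 -> reflect {in B &, injective A} (each_once A B).
Proof.
move=> cB; apply: (iffP idP) => [/forallP H x x' xB x'B E | inj].
  have /cards1P[z Ez] := H (A x').
  have : x \in [set x in B | A x == A x'] by rewrite inE xB E eqxx.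
  have : x' \in [set x in B | A x == A x'] by rewrite inE x'B eqxx.
  by rewrite Ez !inE => /eqP -> /eqP ->.
have im : A @: B = setT.
  by apply/eqP; rewrite eqEcard subsetT cardsT card_ord card_in_imset // cB /=.
apply/forallP=> s; have /imsetP[x xB sE] : s \in A @: B by rewrite im inE.
apply/cards1P; exists x; apply/setP=> z; rewrite !inE; apply/andP/eqP => [[zB /eqP Ez]|->].
  by apply: inj => //; rewrite Ez.
by rewrite xB sE.
Qed.

Section Decomposition.
Variable n : nat.
Implicit Types (A : array n).

Lemma card_line : #|line n| = n ^ 2.
Proof. by rewrite card_prod card_ord mulnn. Qed.

Lemma card_row_cells r : #|@row_cells n r| = n ^ 2.
Proof.
rewrite -card_line -cardsT -(card_imset setT (f := pair r)); last by move=> c c' [].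
apply: eq_card => -[r' c]; rewrite inE /=; apply/eqP/imsetP => [->|[c' _ []]//].
by exists c; rewrite ?inE.
Qed.

Lemma card_col_cells c : #|@col_cells n c| = n ^ 2.
Proof.
rewrite -card_line -cardsT -(card_imset setT (f := pair^~ c)); last by move=> r r' [].
apply: eq_card => -[r c']; rewrite inE /=; apply/eqP/imsetP => [->|[r' _ []]//].
by exists r; rewrite ?inE.
Qed.

Lemma card_box_cells a b : #|@box_cells n a b| = n ^ 2.
Proof.
pose f (p : 'I_n * 'I_n) : line n * line n := ((a, p.1), (b, p.2)).
have injf : injective f by move=> [? ?] [? ?] [-> ->].
rewrite -card_line -cardsT -(card_imset setT injf).
apply: eq_card => -[[a' a2] [b' b2]]; rewrite inE /=.
apply/andP/imsetP => [[/eqP -> /eqP ->]|[? _ [-> _ -> _]]]; last by rewrite !eqxx.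
by exists (a2, b2); rewrite ?inE.
Qed.

Lemma sudokuP A : reflect
  [/\ forall r c c', A (r, c) = A (r, c') -> c = c',
      forall c r r', A (r, c) = A (r', c) -> r = r' &
      forall a b x x', A ((a, x.1), (b, x.2)) = A ((a, x'.1), (b, x'.2)) -> x = x']
  (is_sudoku A).
Proof.
apply: (iffP and3P) => [[/forallP HR /forallP HC /forallP HB]|[HR HC HB]]; split.
- move=> r c c' E; have H := elimT (each_onceP A (card_row_cells r)) (HR r).
  by have [] : (r, c) = (r, c') by apply: H; rewrite ?inE.
- move=> c r r' E; have H := elimT (each_onceP A (card_col_cells c)) (HC c).
  by have [] : (r, c) = (r', c) by apply: H; rewrite ?inE.
- move=> a b [x y] [x' y'] /= E.
  have H := elimT (each_onceP A (card_box_cells a b)) (forallP (HB a) b).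
  have [] : ((a, x), (b, y)) = ((a, x'), (b, y')) :> line n * line n.
    by apply: H; rewrite ?inE ?eqxx.
  by move=> -> ->.
- apply/forallP=> r; apply/(each_onceP _ (card_row_cells r)).
  by move=> [r1 c] [r2 c']; rewrite !inE /= => /eqP-> /eqP-> /HR ->.
- apply/forallP=> c; apply/(each_onceP _ (card_col_cells c)).
  by move=> [r c1] [r' c2]; rewrite !inE /= => /eqP-> /eqP-> /HC ->.
- apply/forallP=> a; apply/forallP=> b; apply/(each_onceP _ (card_box_cells a b)).
  move=> [[a1 x] [b1 y]] [[a2 x'] [b2 y']]; rewrite !inE /=.
  by move=> /andP[/eqP-> /eqP->] /andP[/eqP-> /eqP->] /(HB a b (x, y) (x', y')) [-> ->].
Qed.

Lemma sudoku_row_onto A r s : is_sudoku A -> exists c, A (r, c) = s.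
Proof.
case/and3P=> /forallP/(_ r) HR _ _; have [[r' c]] := each_once_ex s HR.
by rewrite inE /= => /eqP -> <-; exists c.
Qed.

Definition stacks := {ffun 'I_n -> {ffun 'I_n -> {ffun 'I_(n ^ 2) -> 'I_n}}}.

(* [stack_of A a a' s] is the stack containing the occurrence of [s] in row
   [(a, a')]; the default value is never used on a Sudoku square. *)
Definition stack_of A : stacks :=
  [ffun a => [ffun a' => [ffun s =>
    if [pick c | A ((a, a'), c) == s] is Some c then c.1 else a]]].

Definition stack_rel (G : stacks) (b : 'I_n) (r : line n) (s : 'I_(n ^ 2)) :=
  G r.1 r.2 s == b.

(** Disjointness of the rows of a band encodes the box condition: two rows never place a symbol in
    the same stack. *)
Definition valid_stacks : {pred stacks} :=
  ffun_on (mem (wseq n n (fun (_ : 'I_(n ^ 2)) (_ : 'I_n) => true))).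

Lemma stack_ofE A r c : is_sudoku A -> stack_of A r.1 r.2 (A (r, c)) = c.1.
Proof.
case/sudokuP => HR _ _; case: r => a a'; rewrite !ffunE /=.
by case: pickP => [c' /eqP/HR -> //|/(_ c)]; rewrite eqxx.
Qed.

Lemma stack_of_valid A : is_sudoku A -> stack_of A \in valid_stacks.
Proof.
move=> HA; apply/ffun_onP => a; apply/wseqP; split=> [a'|s a1 a2 /=].
  apply/wmatchP; split=> // b.
  pose f b' := A ((a, a'), (b, b')).
  have injf : injective f by case/sudokuP: HA => HR _ _ x y /HR [].
  rewrite -[RHS](card_ord n) -cardsT -(card_imset setT injf); apply: eq_card => s.
  rewrite inE; have [c <-] := sudoku_row_onto (a, a') s HA.
  rewrite (stack_ofE (a, a')) //; apply/eqP/imsetP => [Eb|[b' _]].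
    by exists c.2; rewrite ?inE // /f -Eb -surjective_pairing.
  by case/sudokuP: HA => HR _ _ /HR ->.
have [c1 <-] := sudoku_row_onto (a, a1) s HA.
have [c2 E] := sudoku_row_onto (a, a2) (A ((a, a1), c1)) HA.
rewrite (stack_ofE (a, a1)) // -E (stack_ofE (a, a2)) // => E2.
case/sudokuP: HA => _ _ /(_ a c1.1 (a1, c1.2) (a2, c2.2)) /=.
by rewrite {2}E2 -!surjective_pairing E => /(_ erefl) [].
Qed.

(** In each band a symbol visits [n] distinct stacks in [n] rows, so it meets stack [b] exactly once
    per band. *)
Lemma stack_rel_regular G b : G \in valid_stacks -> regular n n (stack_rel G b).
Proof.
move/ffun_onP=> HG; split=> [[a a']|s].
  by have /wseqP[/(_ a') /wmatchP[_ H] _] := HG a; apply: H.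
rewrite -sum1dep_card -[RHS](card_ord n) -sum1_card.
transitivity (\sum_(a : 'I_n) \sum_(a' | G a a' s == b) 1).
  by rewrite pair_big_dep; apply: eq_bigl => -[x k].
apply: eq_bigr => a _; have /wseqP[_ /(_ s) inj] := HG a.
have [g gK g'K] : bijective (fun a' => G a a' s) by apply: injF_bij.
rewrite (big_pred1 (g b)) // => a' /=.
by rewrite -(inj_eq inj) /= g'K.
Qed.

(** Once [G] is fixed the stacks are independent: [Psi] cuts [A] into its columns, grouped by stack,
    each column a perfect matching of rows with symbols. *)
Lemma card_sudoku_stack_of G : G \in valid_stacks ->
  #|[set A : array n | is_sudoku A & stack_of A == G]|
  = \prod_(b < n) #|wseq 1 n (stack_rel G b)|.
Proof.
move=> HG.
pose Psi A : {ffun 'I_n -> {ffun 'I_n -> {ffun line n -> 'I_(n ^ 2)}}} :=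
  [ffun b => [ffun c => [ffun r => A (r, (b, c))]]].
have PsiE A b c r : Psi A b c r = A (r, (b, c)) by rewrite !ffunE.
have injPsi : injective Psi.
  by move=> A A' E; apply/ffunP=> -[r [b c]]; rewrite -!PsiE E.
pose fam b := mem (wseq 1 n (stack_rel G b)).
transitivity #|(family fam : simpl_pred _)|; last first.
  by rewrite card_family foldrE big_map big_enum.
rewrite -(card_imset _ injPsi); apply: eq_card => H; apply/imsetP/familyP => [[A]|HH].
  rewrite inE => /andP[HA /eqP AG] -> b.
  case/sudokuP: (HA) => HR HC _.
  apply/wseqP; split=> [c|r c c' /=]; last by rewrite !PsiE => /HR [].
  apply: wmatch1_intro => [|r r'|r]; rewrite ?card_line ?card_ord //.
    by rewrite !PsiE; apply: HC.
  by rewrite PsiE /stack_rel -AG stack_ofE.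
have {}HH b : H b \in wseq 1 n (stack_rel G b) by apply: HH.
pose A : array n := [ffun x => H x.2.1 x.2.2 x.1].
have AE r b c : A (r, (b, c)) = H b c r by rewrite ffunE.
have AG r c : G r.1 r.2 (A (r, c)) = c.1.
  case: c => b c; rewrite AE; case/wseqP: (HH b) => /(_ c) /wmatchP[/(_ r) H1 _] _.
  exact/eqP.
have HR r c c' : A (r, c) = A (r, c') -> c = c'.
  move=> E; have := AG r c; rewrite E AG => {}E1.
  case: c c' E1 E => b c [b' c'] /= ->; rewrite !AE.
  by case/wseqP: (HH b) => _ inj /inj ->.
exists A; last by do 3![apply/ffunP=> ?]; rewrite PsiE AE.
have HA : is_sudoku A.
  apply/sudokuP; split=> //.
    move=> [b c] r r'; rewrite !AE.
    by case/wseqP: (HH b) => /(_ c) /wmatch1_inj inj _ /inj.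
  move=> a b [a1 b1] [a2 b2] /= E.
  (* A repeat inside a box would put one symbol in stack [b] from two rows of a band. *)
  have Ea : a1 = a2.
    have := AG (a, a1) (b, b1); have := AG (a, a2) (b, b2); rewrite E /= => {2}<-.
    by have /ffun_onP/(_ a)/wseqP[_ inj] := HG => /esym/inj.
  by move: E; rewrite Ea => /HR [->].
rewrite inE HA /=; apply/eqP/ffunP => a; apply/ffunP=> a'; apply/ffunP=> s.
have [c <-] := sudoku_row_onto (a, a') s HA.
by rewrite (stack_ofE (a, a')) // (AG (a, a')).
Qed.

Lemma num_sudokuE :
  num_sudoku n = \sum_(G in valid_stacks) \prod_(b < n) #|wseq 1 n (stack_rel G b)|.
Proof.
rewrite /num_sudoku -sum1_card (partition_big stack_of valid_stacks) /=; last first.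
  by move=> A; rewrite inE; apply: stack_of_valid.
apply: eq_bigr => G HG; rewrite -card_sudoku_stack_of // sum1dep_card.
by apply: eq_card => A; rewrite !inE.
Qed.

Lemma card_valid_stacks :
  #|valid_stacks| = #|wseq n n (fun (_ : 'I_(n ^ 2)) (_ : 'I_n) => true)| ^ n.
Proof. by rewrite card_ffun_on card_ord. Qed.

End Decomposition.

From mathcomp Require Import all_order all_algebra.
From mathcomp Require Import reals sequences exp lra zify.
Import Order.TTheory GRing.Theory Num.Theory.
Local Open Scope ring_scope.

(** * Bregman's theorem *)

Section Bregman.
Variable R : realType.
Implicit Types (x t : R).

Lemma ln_le_subr1 x : 0 < x -> ln x <= x - 1.
Proof. by move=> x0; have := @le_ln1Dx R (x - 1); rewrite addrCA subrr addr0; apply; lra. Qed.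

(** The convex function [t * ln t] lies above its tangent at [x]. *)
Lemma mul_ln_tangent t x : 0 <= t -> 0 < x -> t * ln x + t - x <= t * ln t.
Proof.
rewrite le_eqVlt => /predU1P[<- x0|t0 x0]; first by rewrite !mul0r; lra.
have := ln_le_subr1 (divr_gt0 x0 t0); rewrite ln_div //.
rewrite -(ler_pM2l t0) !mulrBr mulr1 [t * (x / t)]mulrC divfK ?gt_eqF //; lra.
Qed.

Definition lnfact (k : nat) : R := ln (k`!)%:R.

Lemma lnfactS k : lnfact k.+1 = ln k.+1%:R + lnfact k.
Proof. by rewrite /lnfact factS natrM lnM // posrE ltr0n // fact_gt0. Qed.

Lemma lnfact0 : lnfact 0 = 0. Proof. exact: ln1. Qed.

(** The logarithm of Bregman's factor [(k!)^(1/k)], equal to 0 at [k = 0]. *)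
Definition mean_lnfact (k : nat) : R := lnfact k / k%:R.

Lemma mean_lnfactK k : k%:R * mean_lnfact k = lnfact k.
Proof.
case: k => [|k]; first by rewrite mul0r lnfact0.
by rewrite /mean_lnfact mulrC divfK // pnatr_eq0.
Qed.

(** Prescribing [f i = k] by thinning the relation, rather than deleting vertices, keeps [X] and [Y]
    fixed during the induction. *)
Lemma wmatch_fix_value (X Y : finType) (e : X -> Y -> bool) i k : e i k ->
  wmatch 1 (fun j l => if j == i then l == k else e j l && (l != k))
  = [set f in wmatch 1 e | f i == k].
Proof.
move=> eik; apply/setP=> f; rewrite inE; apply/idP/andP => [Hf|[Hf /eqP fi]].
  case/wmatchP: (Hf) => H1 H2; have fi : f i == k by have := H1 i; rewrite eqxx.
  split=> //; apply/wmatchP; split=> // j.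
  by have := H1 j; case: eqP => [->|_ /andP[]//]; rewrite (eqP fi).
have inj := wmatch1_inj Hf; case/wmatchP: Hf => H1 H2.
apply/wmatchP; split=> // j; case: eqP => [->|/eqP ji]; first by rewrite fi.
by rewrite H1 -fi (inj_eq inj).
Qed.

(* Schrijver's convexity argument.  Rows outside [U] are already matched: they
   have at most one neighbour, which is not adjacent to [U]. *)
Lemma bregman_partial (X Y : finType) (U : {set X}) (e : X -> Y -> bool) :
  (forall i, i \notin U -> exists k, (forall y, e i y -> y = k)
     /\ (forall j, j \in U -> ~~ e j k)) ->
  (0 < #|wmatch 1 e|)%N ->
  ln #|wmatch 1 e|%:R <= \sum_(j in U) mean_lnfact #|[set y | e j y]|.
Proof.
elim: {U}#|U| {-2}U (erefl #|U|) e => [|u IH] U cU e frozen W0.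
  have U0 := cards0_eq cU.
  have -> : #|wmatch 1 e| = 1%N.
    apply/eqP; rewrite eqn_leq W0 andbT; apply/card_le1P => f Hf f'.
    rewrite [RHS]inE; apply/idP/eqP => [|->//]; move: Hf => /wmatchP[H _] /wmatchP[H' _].
    apply/ffunP=> i; have [|k [Hk _]] := frozen i; first by rewrite U0 inE.
    by rewrite (Hk _ (H i)) (Hk _ (H' i)).
  by rewrite ln1 U0 big_set0.
set W := wmatch 1 e in W0 *; set P : R := #|W|%:R.
have P0 : 0 < P by rewrite ltr0n.
pose r j := #|[set y | e j y]|; pose t i k : R := #|[set f in W | f i == k]|%:R.
have r0 i : (0 < r i)%N.
  case/card_gt0P: W0 => f /wmatchP[H _]; apply/card_gt0P; exists (f i).
  by rewrite inE.
have sumW (F : Y -> R) i : \sum_(f in W) F (f i) = \sum_(k | e i k) t i k * F k.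
  rewrite (partition_big (fun f : {ffun X -> Y} => f i) (e i)) /=; last first.
    by move=> f /wmatchP[].
  apply: eq_bigr => k _; rewrite /t -sum1dep_card natr_sum mulr_suml.
  by apply: eq_bigr => f /andP[_ /eqP ->]; rewrite mul1r.
pose B i k := \sum_(j in U :\ i) mean_lnfact (r j - e j k).
(* Convexity, with all tangents taken at the mean [P / r i] of the counts [t i k]. *)
have step1 i : P * ln P <= P * ln (r i)%:R + \sum_(k | e i k) t i k * ln (t i k).
  have Pr : 0 < P / (r i)%:R by rewrite divr_gt0 // ltr0n.
  have : \sum_(k | e i k) (t i k * ln (P / (r i)%:R) + t i k - P / (r i)%:R)
      <= \sum_(k | e i k) t i k * ln (t i k).
    by apply: ler_sum => k _; apply: mul_ln_tangent => //; apply: ler0n.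
  rewrite sumrB big_split /= -mulr_suml.
  have -> : \sum_(k | e i k) t i k = P.
    transitivity (\sum_(f in W) (1 : R)); last by rewrite sumr_const.
    by rewrite (sumW (fun=> 1) i); apply: eq_bigr => k _; rewrite mulr1.
  rewrite sumr_const -[#|e i|](_ : r i = _); last by apply: eq_card => y; rewrite inE.
  rewrite -(mulr_natr (P / (r i)%:R) (r i)) divfK ?pnatr_eq0 -?lt0n // ln_div ?posrE ?ltr0n //.
  by rewrite mulrBr; lra.
(* Induction on [U :\ i] after fixing [f i = k], which costs row [j] one neighbour exactly when
   [e j k]. *)
have step2 i k : i \in U -> e i k -> t i k * ln (t i k) <= t i k * B i k.
  move=> iU eik; rewrite /t; have [->|] := posnP #|[set f in W | f i == k]|.
    by rewrite !mul0r.
  rewrite -(wmatch_fix_value eik) => t0; rewrite ler_wpM2l //.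
  apply: le_trans (IH (U :\ i) _ _ _ t0) _.
  - by move: cU; rewrite (cardsD1 i) iU => -[].
  - move=> j; rewrite !inE negb_and negbK; have [->|ji] /= := eqVneq j i.
      move=> _; exists k; split=> [y /eqP//|j']; rewrite !inE => /andP[/negbTE-> _].
      by rewrite eqxx andbF.
    case/frozen=> k0 [Hk1 Hk2]; exists k0; split=> [y /andP[/Hk1]//|j'].
    by rewrite !inE => /andP[/negbTE-> /Hk2/negbTE->].
  rewrite le_eqVlt; apply/orP; left; apply/eqP; apply: eq_bigr => j.
  rewrite !inE => /andP[/negbTE-> jU]; congr mean_lnfact.
  rewrite /r (cardsD1 k [set y | e j y]) inE addnC addnK.
  by apply: eq_card => y; rewrite !inE andbC.
(* With the sums exchanged, row [j] loses a neighbour for [(r j).-1] of the other rows [i] in [U]: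
   its neighbours are all values of [f] on [U], one of them being [f j]. *)
have step4 f : f \in W -> \sum_(i in U) B i (f i)
    = \sum_(j in U) (u.+1%:R * mean_lnfact (r j) - ln (r j)%:R).
  move=> Hf; have inj := wmatch1_inj Hf.
  rewrite /B (exchange_big_dep (mem U)) /=; last by move=> i j _; rewrite !inE => /andP[].
  apply: eq_bigr => j jU.
  have -> : \sum_(i in U | j \in U :\ i) mean_lnfact (r j - e j (f i))
    = \sum_(i in U :\ j) (mean_lnfact (r j)
        + (e j (f i))%:R * (mean_lnfact (r j).-1 - mean_lnfact (r j))).
    apply: eq_big => i; first by rewrite !inE jU andbT andbC eq_sym.
    by case: (e _ _) => _; rewrite ?subn1 ?subn0 ?mul1r ?mul0r ?addr0 // addrC subrK.
  rewrite big_split /= sumr_const -mulr_suml.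
  have -> : #|U :\ j| = u by move: cU; rewrite (cardsD1 j) jU => -[].
  have -> : \sum_(i in U :\ j) (e j (f i))%:R = (r j).-1%:R :> R.
    rewrite -natr_sum; congr (_%:R).
    have -> : r j = #|[set i in U | e j (f i)]|.
      have [g fK gK] := wmatch1_inv Hf.
      rewrite /r -(card_imset _ inj); apply: eq_card => y; rewrite inE.
      apply/idP/imsetP => [ey|[i]]; last by rewrite inE => /andP[_ ?] ->.
      exists (g y); rewrite ?gK // inE gK ey andbT.
      apply/negPn/negP=> /frozen[k [Hk1 /(_ j jU)]].
      by case/wmatchP: Hf => /(_ (g y)) /Hk1 <- _; rewrite gK ey.
    rewrite (cardsD1 j) inE jU /=; case/wmatchP: (Hf) => -> _ /=.
    rewrite -sum1_card [RHS](eq_bigl (fun i => (i \in U :\ j) && e j (f i))).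
      by rewrite [RHS]big_mkcondr; apply: eq_bigr => i _; case: (e _ _).
    by move=> i; rewrite !inE andbA.
  case: (r j) (r0 j) => // r' _; rewrite [r'.+1.-1]/=.
  have := mean_lnfactK r'.+1; have := mean_lnfactK r'; have := lnfactS r'.
  move: (mean_lnfact r') (mean_lnfact r'.+1) (lnfact _) (lnfact _) (ln _).
  by move=> a b c d l E1 E2 E3; rewrite -[_ *+ u]mulr_natl !mulrS in E3 *; lra.
(* Summing [step1] over [i] in [U] makes the terms [ln (r i)] cancel those of [step4]. *)
have main : u.+1%:R * (P * ln P) <= u.+1%:R * (P * \sum_(j in U) mean_lnfact (r j)).
  have -> : u.+1%:R * (P * ln P) = \sum_(i in U) P * ln P by rewrite sumr_const cU mulr_natl.
  apply: (@le_trans _ _ (\sum_(i in U) (P * ln (r i)%:R + \sum_(k | e i k) t i k * B i k))).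
    apply: ler_sum => i iU; apply: le_trans (step1 i) _; rewrite lerD2l.
    by apply: ler_sum => k; apply: step2.
  rewrite big_split /=; under [X in _ + X]eq_bigr do rewrite -sumW.
  rewrite exchange_big /= (eq_bigr _ step4) sumr_const -[_ *+ #|_|]mulr_natl -/P.
  rewrite -mulr_sumr -mulrDr -big_split /= [X in _ <= X]mulrCA (ler_pM2l P0) mulr_sumr.
  by rewrite (eq_bigr (fun j => u.+1%:R * mean_lnfact (r j))) // => j _; rewrite addrC subrK.
by rewrite -(ler_pM2l P0) -(ler_pM2l (ltr0Sn R u)).
Qed.

Lemma bregman (X Y : finType) (e : X -> Y -> bool) :
  (0 < #|wmatch 1 e|)%N ->
  ln #|wmatch 1 e|%:R <= \sum_j mean_lnfact #|[set y | e j y]|.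
Proof.
move=> W0; have := @bregman_partial X Y setT e _ W0.
by rewrite (eq_bigl xpredT) => [|j]; [apply=> i | ]; rewrite inE.
Qed.

End Bregman.

(** * Quantitative bounds *)

Section Bounds.
Variable R : realType.
Local Notation lnfact := (@lnfact R).
Local Notation mean_lnfact := (@mean_lnfact R).

(** * Elementary Stirling estimates *)

Lemma mul_lnB_le (x y : R) : 0 < x -> 0 < y -> x * (ln y - ln x) <= y - x.
Proof.
move=> x0 y0; have := ln_le_subr1 (divr_gt0 y0 x0); rewrite -ln_div ?posrE //.
by rewrite -(ler_pM2l x0) [leRHS]mulrBr mulr1 [x * (y / x)]mulrC divfK ?gt_eqF.
Qed.

Lemma lnSB_le (k : nat) : k.+1%:R * (ln k.+2%:R - ln k.+1%:R) <= 1 :> R.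
Proof.
by apply: le_trans (mul_lnB_le _ _) _; rewrite // -(natr1 k.+1) addrC addKr.
Qed.

Lemma lnSB_ge (k : nat) : 1 <= k.+2%:R * (ln k.+2%:R - ln k.+1%:R) :> R.
Proof.
have := mul_lnB_le (ltr0Sn R k.+1) (ltr0Sn R k).
by move: (ln _) (ln _) => a b; rewrite -(natr1 k.+1); lra.
Qed.

Lemma lnfact_ge k : k%:R * ln k%:R - k%:R <= lnfact k.
Proof.
elim: k => [|k IH]; first by rewrite mul0r subr0 lnfact0.
rewrite lnfactS; case: k IH => [|k] IH; first by rewrite ln1 lnfact0; lra.
by have := lnSB_le k; rewrite -(natr1 k.+1) in IH *; lra.
Qed.

(** With [K = k.+1] this reads [K! <= e K (K/e)^K]. *)
Lemma lnfact_le k : lnfact k.+1 <= k.+2%:R * ln k.+1%:R - k%:R.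
Proof.
elim: k => [|k IH]; first by rewrite lnfactS lnfact0 ln1; lra.
rewrite lnfactS; have := lnSB_ge k; move: IH.
move: (ln k.+2%:R) (ln k.+1%:R) (lnfact k.+1) => a b c.
by rewrite -(natr1 k.+2) -(natr1 k.+1) -(natr1 k); lra.
Qed.

Lemma mean_lnfact_le k :
  mean_lnfact k.+1 <= ln k.+1%:R - 1 + (1 + ln k.+1%:R) / k.+1%:R.
Proof.
have k0 : 0 < k.+1%:R :> R by [].
rewrite -(ler_pM2l k0) mean_lnfactK mulrDr mulrCA divff ?gt_eqF //.
by apply: le_trans (lnfact_le k) _; rewrite -(natr1 k.+1) -(natr1 k); lra.
Qed.

(** This is the passage [m -> oo]: an error linear in [m] is negligible against [2 ^ m]. *)
Lemma exp2_linear_le0 (a c : R) :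
  (forall m, (2 ^ m)%:R * a <= c * m.+1%:R) -> a <= 0.
Proof.
move=> H; rewrite leNgt; apply/negP => a0.
have c0 : 0 <= c by have := H 0%N; rewrite mulr1; apply: le_trans; rewrite mul1r ltW.
(* Use [m = j + j]: one factor [2 ^ j] absorbs [m.+1], the other exceeds [j]. *)
suff Hj j : j%:R * a <= 2 * c.
  have := Hj (Num.truncn (2 * c / a)).+1; rewrite leNgt => /negP; apply.
  by rewrite -ltr_pdivrMr // Num.Theory.truncnS_gt.
have j1 : (j.+1 <= 2 ^ j)%N by apply: ltn_expl.
have p0 : 0 < (2 ^ j)%:R :> R by rewrite ltr0n expn_gt0.
apply: (@le_trans _ _ ((2 ^ j)%:R * a)).
  by rewrite ler_pM2r // ler_nat ltnW.
rewrite -(ler_pM2l p0) mulrA -natrM -expnD; apply: le_trans (H _) _.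
have : (j + j).+1%:R <= (2 ^ j)%:R * 2 :> R by rewrite -natrM ler_nat; lia.
by move/(ler_wpM2l c0) => /le_trans -> //; rewrite le_eqVlt; apply/orP; left; apply/eqP; ring.
Qed.

Lemma wmatch_lower (X Y : finType) d (e : X -> Y -> bool) :
  regular d.+1 d.+1 e ->
  #|X|%:R * (ln d.+1%:R - 1) <= ln #|wmatch 1 e|%:R :> R.
Proof.
move=> H; have p0 : (0 < #|wmatch 1 e|)%N.
  by have [f Hf] := regular_matching H; apply/card_gt0P; exists f.
have lnn (a k : nat) : (0 < a)%N -> ln (a ^ k)%:R = k%:R * ln a%:R :> R.
  by move=> a0; rewrite natrX lnXn ?ltr0n // mulr_natl.
have lnm (a b : nat) : (0 < a)%N -> (0 < b)%N -> ln (a * b)%:R = ln a%:R + ln b%:R :> R.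
  by move=> a0 b0; rewrite natrM lnM ?posrE ?ltr0n.
(* After taking logarithms and using Stirling, the terms [k ln k] cancel for [k = 2 ^ m]; what
   remains is [ln k.+1 <= m.+1], once per vertex of [X] and colour. *)
rewrite -subr_le0; apply: (@exp2_linear_le0 _ (#|X|%:R * d.+1%:R)) => m.
have k0 : (0 < 2 ^ m)%N by rewrite expn_gt0.
have lnle (a b : nat) : (0 < a)%N -> (a <= b)%N -> ln a%:R <= ln b%:R :> R.
  by move=> a0 ab; rewrite ler_ln ?posrE ?ltr0n ?ler_nat // (leq_trans a0).
have ln2m : ln (2 ^ m).+1%:R <= m.+1%:R :> R.
  apply: (@le_trans _ _ (ln (2 ^ m.+1)%:R)); first by apply: lnle => //; rewrite expnS; lia.
  rewrite lnn // ler_piMr //; apply: le_trans (ln_le_subr1 _) _ => //; lra.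
have /lnle := wmatch_lower_nat m H.
rewrite !expn_gt0 muln_gt0 !expn_gt0 fact_gt0 => /(_ isT).
move: (2 ^ m)%N k0 ln2m => k k0 ln2m; have := lnfact_ge k.
rewrite !(lnn, lnm) ?muln_gt0 ?expn_gt0 ?fact_gt0 ?k0 ?p0 // -/(lnfact k) natrM.
move: (ln #|_|%:R) (ln d.+1%:R) (lnfact k) (ln k%:R) (ln _) ln2m => p a b c l ln2m E1 E2.
have := ler_wpM2l (mulr_ge0 (ler0n R #|X|) (ler0n R d.+1)) ln2m.
have := ler_wpM2l (ler0n R #|X|) E1.
lra.
Qed.

(** * Bounds for [w]-to-one matchings and sequences of them *)

Section WMatch.
Variables (X Y : finType) (w : nat).
Hypothesis w0 : (0 < w)%N.

(** Here [i] is the degree on the side of [X]. Replacing each [y] by [w] copies gives degree [w * i]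
    on both sides and multiplies the count by [w!] for every [y]. *)
Definition match_lo i : R := #|X|%:R * (ln (w * i)%:R - 1) - #|Y|%:R * lnfact w.
Definition match_up i : R := #|X|%:R * mean_lnfact (w * i) - #|Y|%:R * lnfact w.

Lemma wmatch_bounds d (e : X -> Y -> bool) : regular d.+1 (w * d.+1) e ->
  expR (match_lo d.+1) <= #|wmatch w e|%:R <= expR (match_up d.+1).
Proof.
move=> [H1 H2].
pose e1 x (p : Y * 'I_w) := e x p.1.
have [k kE] : exists k, (w * d.+1 = k.+1)%N by case: w w0 => // w' _; exists (d + w' * d.+1)%N.
have r1 x : #|[set y | e1 x y]| = k.+1.
  rewrite -kE mulnC -(H1 x) -[w in RHS]card_ord -cardsT -cardsX.
  by apply: eq_card => p; rewrite !inE andbT.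
have H : regular k.+1 k.+1 e1 by split=> // -[y j]; rewrite -kE -(H2 y).
have p0 : (0 < #|wmatch 1 e1|)%N.
  by have [f Hf] := regular_matching H; apply/card_gt0P; exists f.
have E := card_wmatch_blowup 'I_w e; rewrite card_ord -/e1 in E.
have W0 : (0 < #|wmatch w e|)%N by move: p0; rewrite E muln_gt0 => /andP[].
have lnW : ln #|wmatch w e|%:R = ln #|wmatch 1 e1|%:R - #|Y|%:R * lnfact w :> R.
  rewrite E natrM lnM ?posrE ?ltr0n ?expn_gt0 ?fact_gt0 // natrX lnXn ?ltr0n ?fact_gt0 //.
  by rewrite -/(lnfact w) mulr_natl addrK.
have Wp : #|wmatch w e|%:R \is @Num.pos R by rewrite posrE ltr0n.
rewrite -[X in _ <= X <= _](lnK Wp) !ler_expR lnW /match_lo /match_up !lerD2r kE.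
rewrite wmatch_lower //=; apply: le_trans (bregman R p0) _.
by rewrite (eq_bigr (fun=> mean_lnfact k.+1)) ?sumr_const ?mulr_natl // => x _; rewrite r1.
Qed.

(** Whichever matching is removed, the remaining graph is regular of the next lower degree, so the
    bounds multiply. *)
Lemma wseq_bounds d (e : X -> Y -> bool) : regular d (w * d) e ->
  expR (\sum_(i < d) match_lo i.+1) <= #|wseq w d e|%:R
    <= expR (\sum_(i < d) match_up i.+1).
Proof.
elim: d e => [|d IH] e He.
  rewrite !big_ord0 expR0; suff -> : #|wseq w 0 e| = 1%N by rewrite lexx.
  rewrite -[RHS](cards1 (ffun0 (card_ord 0) : {ffun 'I_0 -> {ffun X -> Y}})).
  apply: eq_card => F; rewrite in_set1; apply/wseqP/eqP => [_|_]; first by apply/ffunP => -[].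
  by split=> [[]|? []].
have /andP[lo up] := wmatch_bounds He.
rewrite card_wseqS natr_sum !big_ord_recr /= (expRD _ (match_lo _)) (expRD _ (match_up _)).
have Hf f : f \in wmatch w e -> _ := fun Hf => IH _ (regular_minus He Hf).
apply/andP; split.
  apply: (@le_trans _ _ (#|wmatch w e|%:R * expR (\sum_(i < d) match_lo i.+1))).
    by rewrite [leLHS]mulrC ler_pM2r ?expR_gt0.
  by rewrite mulr_natl -sumr_const; apply: ler_sum => f /Hf /andP[].
apply: (@le_trans _ _ (#|wmatch w e|%:R * expR (\sum_(i < d) match_up i.+1))); last first.
  by rewrite [leRHS]mulrC ler_pM2r ?expR_gt0.
by rewrite mulr_natl -sumr_const; apply: ler_sum => f /Hf /andP[].
Qed.
End WMatch.

(** * Summation of the exponents over the degrees *)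

Lemma harmonic_le n : \sum_(i < n.+1) i.+1%:R^-1 <= 1 + ln n.+1%:R :> R.
Proof.
elim: n => [|n IH]; first by rewrite big_ord1 ln1 invr1 addr0.
rewrite big_ord_recr /=; have := lnSB_ge n.
rewrite -ler_pdivrMl // mulr1; move: IH.
move: (\sum_(_ < _) _) (ln n.+1%:R) (ln n.+2%:R) (n.+2%:R^-1) => a b c d; lra.
Qed.

Lemma sum_ln n : \sum_(i < n) ln i.+1%:R = lnfact n :> R.
Proof.
by elim: n => [|n IH]; [rewrite big_ord0 lnfact0 | rewrite big_ord_recr /= IH lnfactS addrC].
Qed.

Lemma ln_nat_ge0 n : 0 <= ln n.+1%:R :> R.
Proof. by rewrite ln_ge0 // ler1n. Qed.

(** For stage two; the squared logarithm comes from summing the errors [(1 + ln i) / i]. *)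
Lemma sum_mean_lnfact n : \sum_(i < n.+1) mean_lnfact i.+1
  <= n.+1%:R * (ln n.+1%:R - 2) + 1 + ln n.+1%:R + (1 + ln n.+1%:R) ^+ 2.
Proof.
have l0 := ln_nat_ge0 n.
apply: (@le_trans _ _ (\sum_(i < n.+1) (ln i.+1%:R - 1 + (1 + ln n.+1%:R) * i.+1%:R^-1))).
  apply: ler_sum => i _; apply: le_trans (mean_lnfact_le i) _; rewrite lerD2l.
  by rewrite ler_pM2r ?invr_gt0 // lerD2l ler_ln ?posrE // ler_nat.
rewrite big_split sumrB /= sum_ln -mulr_sumr sumr_const card_ord.
have l1 : 0 <= 1 + ln n.+1%:R :> R by lra.
have := ler_wpM2l l1 (harmonic_le n); have := lnfact_le n.
rewrite -(natr1 n.+1); move: (ln _) (lnfact _) (\sum_(_ < _) _) => a b c.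
by rewrite -(natr1 n); lra.
Qed.

(** For stage one; [lnfact n.+1] is left unexpanded because it cancels against the term
    [#|Y| * lnfact w] of [match_up]. *)
Lemma sum_mean_lnfact_mul n : \sum_(i < n.+1) mean_lnfact (n.+1 * i.+1)
  <= n.+1%:R * (ln n.+1%:R - 1) + lnfact n.+1 + 1 + 2 * ln n.+1%:R.
Proof.
have l0 := ln_nat_ge0 n.
apply: (@le_trans _ _ (\sum_(i < n.+1)
  (ln i.+1%:R + (ln n.+1%:R - 1 + (1 + 2 * ln n.+1%:R) / n.+1%:R)))).
  apply: ler_sum => i _.
  have [k kE] : exists k, (n.+1 * i.+1 = k.+1)%N by exists (i + n * i.+1)%N.
  have lnE : ln k.+1%:R = ln n.+1%:R + ln i.+1%:R :> R by rewrite -kE natrM lnM ?posrE.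
  rewrite kE; apply: le_trans (mean_lnfact_le k) _; rewrite lnE.
  have li : ln i.+1%:R <= ln n.+1%:R :> R by rewrite ler_ln ?posrE // ler_nat.
  have : (1 + (ln n.+1%:R + ln i.+1%:R)) / k.+1%:R <= (1 + 2 * ln n.+1%:R) / n.+1%:R :> R.
    apply: ler_pM; rewrite ?invr_ge0 //; first by have := ln_nat_ge0 i; lra.
      by lra.
    by rewrite lef_pV2 ?posrE // ler_nat -kE leq_pmulr.
  by move: (_ / k.+1%:R) (_ / n.+1%:R) => a b; lra.
rewrite big_split /= sum_ln sumr_const card_ord -[_ *+ _]mulr_natl mulrDr.
rewrite [_ * (_ / _)]mulrC divfK ?pnatr_eq0 //.
lra.
Qed.
End Bounds.

From mathcomp Require Import all_classical all_reals all_analysis.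
Import Order.TTheory GRing.Theory Num.Theory.
Import numFieldNormedType.Exports.
Local Open Scope classical_set_scope.
Local Open Scope ring_scope.

(** * Asymptotics *)

(** With [l = ln m], each of the [m] bands contributes about [m^3 (l - 1)] and each of the [m]
    stacks about [m^3 (l - 2)]; hence the [3] in the exponent. *)
Lemma num_sudoku_bounds (R : realType) n :
  (0 < num_sudoku n.+1)%N /\
  (n.+1 ^ 4)%:R * (2 * ln n.+1%:R - 3) <= ln (R := R) (num_sudoku n.+1)%:R
    <= (n.+1 ^ 4)%:R * (2 * ln n.+1%:R - 3)
       + (n.+1 ^ 3)%:R * (3 * (1 + ln n.+1%:R) ^+ 2).
Proof.
set l : R := ln n.+1%:R; set m := n.+1.
have full : regular m (m * m) (fun (_ : 'I_(m ^ 2)) (_ : 'I_m) => true).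
  split=> [x|y]; first by rewrite -[RHS]card_ord; apply: eq_card => i; rewrite inE.
  by rewrite mulnn -[RHS]card_ord; apply: eq_card => i; rewrite inE.
have m0 : (0 < m)%N by [].
have := wseq_bounds R m0 full.
set L1 := \sum_(_ < _) _; set U1 := \sum_(_ < _) _; case/andP => lo1 up1.
set L2 : R := \sum_(i < m) @match_lo R (line m) 'I_(m ^ 2) 1 i.+1.
set U2 : R := \sum_(i < m) @match_up R (line m) 'I_(m ^ 2) 1 i.+1.
have bnd2 G b : G \in @valid_stacks m ->
    expR L2 <= #|wseq 1 m (@stack_rel m G b)|%:R <= expR U2.
  move=> HG; apply: (wseq_bounds R (ltn0Sn 0)).
  by have := stack_rel_regular b HG; rewrite mul1n.
have sumE : (num_sudoku m)%:R
    = \sum_(G in @valid_stacks m) \prod_(b < m) #|wseq 1 m (@stack_rel m G b)|%:R :> R.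
  by rewrite num_sudokuE natr_sum; apply: eq_bigr => G _; rewrite natr_prod.
have cV : #|@valid_stacks m|%:R
    = #|wseq m m (fun (_ : 'I_(m ^ 2)) (_ : 'I_m) => true)|%:R ^+ m :> R.
  by rewrite card_valid_stacks natrX.
have constE (x : R) : \sum_(G in @valid_stacks m) \prod_(b < m) x
    = #|@valid_stacks m|%:R * x ^+ m.
  by rewrite sumr_const prodr_const card_ord mulr_natl.
have lo : expR (m%:R * (L1 + L2)) <= (num_sudoku m)%:R.
  apply: (@le_trans _ _ (#|@valid_stacks m|%:R * expR L2 ^+ m)).
    rewrite expRM_natl expRD exprMn cV ler_pM2r ?exprn_gt0 ?expR_gt0 //.
    by rewrite lerXn2r ?nnegrE ?expR_ge0 // ler0n.
  rewrite sumE -constE; apply: ler_sum => G HG; apply: ler_prod => b _.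
  by rewrite expR_ge0; have /andP[] := bnd2 G b HG.
have up : (num_sudoku m)%:R <= expR (m%:R * (U1 + U2)).
  apply: (@le_trans _ _ (#|@valid_stacks m|%:R * expR U2 ^+ m)); last first.
    rewrite expRM_natl expRD exprMn cV ler_pM2r ?exprn_gt0 ?expR_gt0 //.
    by rewrite lerXn2r ?nnegrE ?expR_ge0 // ler0n.
  rewrite sumE -constE; apply: ler_sum => G HG; apply: ler_prod => b _.
  by rewrite ler0n; have /andP[] := bnd2 G b HG.
have N0 : 0 < (num_sudoku m)%:R :> R by apply: lt_le_trans lo; apply: expR_gt0.
split; first by rewrite -(ltr0n R).
have {lo}lo : m%:R * (L1 + L2) <= ln (num_sudoku m)%:R by rewrite -ler_expR lnK ?posrE.
have {up}up : ln (num_sudoku m)%:R <= m%:R * (U1 + U2) by rewrite -ler_expR lnK ?posrE.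
have cS : #|'I_(m ^ 2)|%:R = m%:R ^+ 2 :> R by rewrite card_ord natrX.
have cl : #|line m|%:R = m%:R ^+ 2 :> R by rewrite card_line natrX.
have lnm i : ln (m * i.+1)%:R = l + ln i.+1%:R :> R by rewrite natrM lnM ?posrE.
have L1E : L1 = m%:R ^+ 3 * (l - 1).
  pose c : R := m%:R ^+ 2 * (l - 1) - m%:R * lnfact R m.
  rewrite /L1 /match_lo cS card_ord.
  rewrite (eq_bigr (fun i : 'I_m => m%:R ^+ 2 * ln i.+1%:R + c)) => [|i _]; last first.
    by rewrite lnm /c; ring.
  rewrite big_split /= -mulr_sumr sum_ln sumr_const card_ord -(mulr_natl c) /c.
  by move: m%:R (lnfact R m) => a b; ring.
have L2E : L2 = m%:R ^+ 2 * (lnfact R m - m%:R).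
  rewrite /L2 /match_lo cl cS /lnfact ln1 mulr0.
  under eq_bigr do rewrite mul1n subr0.
  by rewrite -mulr_sumr sumrB sum_ln sumr_const card_ord.
have U1E : U1 <= m%:R ^+ 3 * (l - 1) + m%:R ^+ 2 * (1 + 2 * l).
  rewrite /U1 /match_up cS card_ord sumrB sumr_const card_ord -mulr_sumr.
  have := ler_wpM2l (exprn_ge0 2 (ler0n R m)) (sum_mean_lnfact_mul R n).
  by rewrite -/m -/l -[_ *+ m]mulr_natl; lra.
have U2E : U2 <= m%:R ^+ 2 * (m%:R * (l - 2) + 1 + l + (1 + l) ^+ 2).
  rewrite /U2 /match_up cl cS /lnfact ln1 mulr0.
  under eq_bigr do rewrite mul1n subr0.
  by rewrite -mulr_sumr ler_pM2l ?exprn_gt0 // sum_mean_lnfact.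
have m0' : 0 <= m%:R :> R by rewrite ler0n.
have l0 : 0 <= l := ln_nat_ge0 R n.
apply/andP; split.
  apply: le_trans lo; rewrite L1E L2E !natrX.
  have := lnfact_ge R m; rewrite -/l => /(ler_wpM2l (exprn_ge0 3 m0')); lra.
apply: le_trans up _; rewrite !natrX.
(* The error terms [1 + 2 l], [1 + l] and [(1 + l)^2] are each at most [(1 + l)^2]. *)
have : 0 <= m%:R ^+ 3 * (3 * (1 + l) ^+ 2 - (1 + 2 * l) - (1 + l + (1 + l) ^+ 2)).
  by apply: mulr_ge0; [apply: exprn_ge0 | nra].
have := ler_wpM2l m0' (lerD U1E U2E); lra.
Qed.

(** With [s] the fourth root of [x], [1 + ln x = 1 + 4 ln s <= 4 s]. *)
Lemma ln_sqr_le (R : realType) (x : R) :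
  1 <= x -> (1 + ln x) ^+ 2 <= 16 * Num.sqrt x.
Proof.
move=> x1; set q := Num.sqrt x; set s := Num.sqrt q.
have x0 : 0 <= x by lra.
have q1 : 1 <= q by rewrite -[leLHS]sqrtr1 ler_wsqrtr.
have s1 : 1 <= s by rewrite -[leLHS]sqrtr1 ler_wsqrtr.
have qE : q = s ^+ 2 by rewrite sqr_sqrtr //; lra.
have s0 : 0 < s by lra.
have -> : x = s ^+ 4 by rewrite (exprM s 2 2) -qE sqr_sqrtr.
have l0 : 0 <= ln s by apply: ln_ge0.
have l1 := ln_le_subr1 s0.
rewrite lnXn // -mulr_natl qE; nra.
Qed.

Theorem theorem2p7 (R : realType) :
  exists f : nat -> R,
    f =o_\oo (fun n : nat => n%:R ^+ 2 : R) /\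
    (forall n : nat, (0 < n)%N ->
       (num_sudoku n)%:R = (n%:R ^+ 2 / expR 3 + f n) ^+ (n ^ 4)%N).
Proof.
(* For positive [n], the logarithm of the ratio of the [n^4]-th root of the count to [n^2 / e^3]. *)
pose del n : R := ln (num_sudoku n)%:R / (n ^ 4)%:R - (2 * ln n%:R - 3).
exists (fun n => n%:R ^+ 2 / expR 3 * (expR (del n) - 1)); split; last first.
  case=> // n _; have [N0 _] := num_sudoku_bounds R n.
  rewrite mulrBr mulr1 addrC subrK.
  have -> : n.+1%:R ^+ 2 / expR 3 = expR (2 * ln n.+1%:R - 3) :> R.
    by rewrite [RHS]expRD expRN expRM_natl lnK ?posrE.
  rewrite -expRD addrC subrK -expRM_natl mulrC divfK ?lnK ?posrE ?ltr0n //.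
(* [eta] is chosen so that [del n <= eta] means [expR (del n) - 1 <= eps]. *)
apply/eqoP => eps eps0; set eta := ln (1 + eps).
have eta0 : 0 < eta by rewrite ln_gt0 // ltrDl.
(* The constant 48 is 3, from the error term of [num_sudoku_bounds], times 16, from [ln_sqr_le]. *)
have del_le n : (48 / eta) ^+ 2 < n.+1%:R -> 0 <= del n.+1 <= eta.
  move=> nbig; have n1 : 1 <= n.+1%:R :> R by rewrite ler1n.
  have [_ /andP[lo up]] := num_sudoku_bounds R n.
  have n4 : 0 < (n.+1 ^ 4)%:R :> R by rewrite ltr0n expn_gt0.
  rewrite /del subr_ge0 ler_pdivlMr // mulrC lo /= lerBlDr ler_pdivrMr //.
  suff : (n.+1 ^ 3)%:R * (3 * (1 + ln n.+1%:R) ^+ 2) <= eta * (n.+1 ^ 4)%:R.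
    by move=> H; apply: le_trans up _; rewrite [leRHS]mulrDl addrC lerD // mulrC.
  have -> : (n.+1 ^ 4)%:R = (n.+1 ^ 3)%:R * n.+1%:R :> R by rewrite -natrM -expnSr.
  rewrite [leRHS]mulrCA ler_wpM2l //.
  apply: (@le_trans _ _ (3 * (16 * Num.sqrt n.+1%:R))).
    by rewrite ler_pM2l // ln_sqr_le.
  set q := Num.sqrt _.
  have qE : n.+1%:R = q ^+ 2 :> R by rewrite sqr_sqrtr.
  have q0 : 0 <= q by apply: sqrtr_ge0.
  have : 48 / eta <= q.
    by rewrite -(ler_pXn2r (n := 2)) ?nnegrE ?divr_ge0 // -?qE ltW.
  rewrite ler_pdivrMr // qE => H; have := ler_wpM2l q0 H; lra.
near=> n.
have n0 : (0 < n)%N by near: n; exists 1%N.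
have /andP[d0 d1] : 0 <= del n <= eta.
  rewrite -(prednK n0); apply: del_le; rewrite prednK //.
  by near: n; exact: nbhs_infty_gtr.
have e3 : expR (- 3) <= 1 :> R by rewrite -[leRHS]expR0 ler_expR; lra.
have E1 : 1 <= expR (del n) by rewrite -[leLHS]expR0 ler_expR.
have E2 : expR (del n) - 1 <= eps.
  by rewrite lerBlDl -[leRHS]lnK ?ler_expR // posrE; lra.
rewrite ger0_norm; last by rewrite !mulr_ge0 ?invr_ge0 ?expR_ge0 ?sqr_ge0 ?exprn_ge0 //; lra.
rewrite ger0_norm ?exprn_ge0 // [leRHS]mulrC -mulrA ler_wpM2l ?exprn_ge0 //.
rewrite -expRN -[leRHS]mul1r ler_pM ?expR_ge0 //; lra.
Unshelve. all: by end_near.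
Qed.
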